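(* Let $\triangle ABC\subset\mathbb{S}^2$ be a right spherical triangle with right angle at $C$, and let $a$ and $b$ denote the arclengths of the sides $BC$ and $CA$ respectively. Then \[4\pi\, M_A(\triangle ABC)=\tfrac12\, a\sin b,\qquad\text{where } M_A(R):=\int_R X\cdot A\,d\mu(X).\]
   Context: $\mathbb{S}^2\subset\mathbb{R}^3$ is the unit sphere, $\mu$ is the uniform probability measure on $\mathbb{S}^2$, and the vertices $A,B,C$ are regarded as unit vectors in $\mathbb{R}^3$. Side $a$ is opposite vertex $A$ and side $b$ is opposite vertex $B$. *)

(* Defs.v *)
From HB Require Import structures.
From mathcomp Require Import all_boot all_order all_algebra.
From mathcomp Require Import all_classical all_reals all_analysis.
Set Implicit Arguments. Unset Strict Implicit. Unset Printing Implicit Defensive.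
Import Order.TTheory GRing.Theory Num.Theory.
Local Open Scope classical_set_scope.
Local Open Scope ring_scope.

Section Sphere.
Variable R : realType.

Definition vec3 := ((R * R) * R)%type.

Definition vadd (u v : vec3) : vec3 :=
  ((u.1.1 + v.1.1, u.1.2 + v.1.2), u.2 + v.2).
Definition vscale (k : R) (u : vec3) : vec3 :=
  ((k * u.1.1, k * u.1.2), k * u.2).
Definition dot (u v : vec3) : R := u.1.1 * v.1.1 + u.1.2 * v.1.2 + u.2 * v.2.
Definition vnorm (u : vec3) : R := Num.sqrt (dot u u).
Definition det3 (u v w : vec3) : R :=
  u.1.1 * (v.1.2 * w.2 - v.2 * w.1.2)
  - u.1.2 * (v.1.1 * w.2 - v.2 * w.1.1)
  + u.2 * (v.1.1 * w.1.2 - v.1.2 * w.1.1).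

Definition origin3 : vec3 := ((0, 0), 0).

Definition sphere2 : set vec3 := [set X | dot X X = 1].

Definition leb3 := ((@lebesgue_measure R \x @lebesgue_measure R) \x
                     @lebesgue_measure R)%E.

Definition ball3 : set vec3 := [set x | vnorm x <= 1].
Definition radproj (x : vec3) : vec3 := vscale (vnorm x)^-1 x.

(* Integral over a region Rg of S^2 against the uniform probability measure mu
   on S^2.  mu is the normalized cone measure (the rotation-invariant
   probability on S^2): mu(E) = leb3({x in ball3, x <> 0, x/|x| in E})/leb3(ball3),
   i.e. the pushforward of the normalized Lebesgue measure on the unit ball
   under x |-> x/|x|; the integral is the corresponding pushforward integral. *)
Definition sphere_integral (Rg : set vec3) (f : vec3 -> R) : \bar R :=
  ((\int[leb3]_(x in ball3 `&` [set x | x <> origin3] `&` radproj @^-1` Rg)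
       (f (radproj x))%:E) / leb3 ball3)%E.

Definition MA (A : vec3) (Rg : set vec3) : \bar R :=
  sphere_integral Rg (fun X => dot X A).

(* A (nondegenerate) spherical triangle with unit vertices A, B, C:
   the vertices are linearly independent and the triangle is the
   intersection of S^2 with the cone spanned by A, B, C. *)
Definition sph_triangle (A B C : vec3) : set vec3 :=
  [set X | sphere2 X /\ exists al be ga : R,
     0 <= al /\ 0 <= be /\ 0 <= ga /\
     X = vadd (vadd (vscale al A) (vscale be B)) (vscale ga C)].

Definition arclen (U V : vec3) : R := acos (dot U V).

Definition tangent_at (C U : vec3) : vec3 := vadd U (vscale (- dot U C) C).
Definition sph_angle (C A B : vec3) : R :=
  acos (dot (tangent_at C A) (tangent_at C B) /
        (vnorm (tangent_at C A) * vnorm (tangent_at C B))).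

End Sphere.

(* Main.v *)
Require Import Defs.
From HB Require Import structures.
From mathcomp Require Import all_boot all_order all_algebra.
From mathcomp Require Import all_classical all_reals all_analysis.
From mathcomp Require Import measurable_realfun ring lra.
Set Implicit Arguments. Unset Strict Implicit. Unset Printing Implicit Defensive.
Import Order.TTheory GRing.Theory Num.Theory.
Import numFieldNormedType.Exports.
Local Open Scope classical_set_scope.
Local Open Scope ring_scope.

(** On [R^3] the function [X . A / |X|] is the derivative of [|X|] in the direction [A].
In the coordinates [X = x C + y B + z A] (a linear change of variables of Jacobian
[|det3 C B A|]) the cone over the triangle is the octant [x, y, z >= 0], and integrating in
[z] first leaves [1 - |x C + y B|] if [x C + y B] lies in the unit ball and [0] otherwise.
The substitution [y = s x] then splits the planar integral into
[\int_0^oo ds / (1 + 2 s cos a + s^2) = a / sin a] and [\int_0^1 r (1 - r) dr = 1/6].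
The right angle gives [|det3 C B A| = sin a sin b], and the ball has volume [4 pi / 3]. *)

(** * Linear changes of variables in R^3 *)

(** The direction [A] is integrated first because every exit from the ball has norm 1: what remains
    is a function of [|x C + y B|] alone, and [A] survives only in the determinant. The factor [a]
    then appears as the opening angle of the planar sector between [C] and [B], and [1 / sin a] as
    the price of the skew coordinates. The obstacle is the sign: [X . A] is negative at points more
    than a quarter circle from [A], so Tonelli alone does not justify the reordering. The change of
    variables is established for nonnegative functions and carried over to integrable ones;
    integrability follows from Cauchy-Schwarz and the finite volume of the ball. That volume is
    itself an instance of the planar formula, with angle [pi / 2]. All substitutions reduce to
    affine ones in a single variable, so no trigonometric change of coordinates occurs. *)

Section leb2.
Variable R : realType.
Local Notation RM := (measurableTypeR R).
Local Open Scope ereal_scope.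

(* A product of sigma-finite measures has no canonical sigma-finite structure: Fubini needs
   this instance to apply to [leb3]. *)
Definition leb2 : set (RM * RM)%type -> \bar R :=
  (@lebesgue_measure R \x @lebesgue_measure R).
HB.instance Definition _ := Measure.on leb2.

Let sigma_finite_leb2 : sigma_finite setT leb2.
Proof.
pose I n : set RM := `[(- n%:R)%R, n%:R]%classic.
exists (fun n => I n `*` I n).
  apply/seteqP; split=> // -[x y] _.
  have [n xn] : exists n, (`|x| <= n%:R /\ `|y| <= n%:R)%R.
    exists (Num.trunc (Num.max `|x| `|y|)%R).+1.
    by apply/andP; rewrite -ge_max; apply: ltW; exact: truncnS_gt.
  by exists n => //; rewrite /I /= !in_itv/= -!ler_norml.
move=> n; have mI : measurable (I n) by exact: measurable_itv.
split; first exact: measurableX.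
have fI : @lebesgue_measure R (I n) < +oo.
  by rewrite lebesgue_measure_itv/=; case: ifP => //; rewrite -EFinB ltry.
by rewrite /leb2 product_measure1E// lte_mul_pinfty// ge0_fin_numE.
Qed.

HB.instance Definition _ := Measure_isSigmaFinite.Build _ _ _ leb2 sigma_finite_leb2.
End leb2.

Section affine.
Variable R : realType.
Local Notation RM := (measurableTypeR R).
Local Notation mu := (@lebesgue_measure R).
Local Open Scope ereal_scope.

Lemma measurable_affine (k c : R) : measurable_fun setT ((fun x => k * x + c)%R : RM -> RM).
Proof. by apply: measurable_funD => //; exact: measurable_funM. Qed.

(** The pushforward of Lebesgue measure under the affine map, multiplied by [|k|], gives every
    interval []a, b]] its length, and these values determine the measure. *)
Lemma ge0_integral_affine (k c : R) (G : RM -> \bar R) : k != 0%R ->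
  measurable_fun setT G -> (forall x, 0 <= G x) ->
  (`|k|%R)%:E * \int[mu]_x G (k * x + c)%R = \int[mu]_x G x.
Proof.
move=> k0 mG G0.
have mphi := measurable_affine k c.
have kge0 : (0 <= `|k|)%R by [].
have := ge0_integral_pushforward mphi lebesgue_measure measurableT mG (fun y _ => G0 y).
rewrite preimage_setT /= => <-.
rewrite -(ge0_integral_mscale _ measurableT (NngNum kge0) mG (fun y _ => G0 y)).
apply: eq_measure_integral => A mA _; apply/esym; apply: lebesgue_measure_unique => //.
  move=> X [[a b] _ <-]/=.
  rewrite /mscale /= /pushforward lebesgue_measure_itv/= lte_fin.
  have [kneg|kpos|kz] := ltgtP k 0%R; last by rewrite kz eqxx in k0.
  (* A negative slope exchanges the open and the closed end of the interval. *)
  - rewrite (_ : _ @^-1` _ = `[((b - c) / k)%R, ((a - c) / k)%R[)%classic; last first.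
      apply/seteqP; split=> x /=; rewrite !in_itv/= ler_ndivrMr// ltr_ndivlMr// => /andP[? ?];
        by apply/andP; split; nra.
    rewrite lebesgue_measure_itv/= lte_fin ltr_ndivlMr// divfK//.
    rewrite ltrBlDr subrK; case: ifPn => ab; last by rewrite mule0.
    rewrite -!EFinD -EFinM ltr0_norm//; congr _%:E; field.
    by rewrite lt_eqF.
  - rewrite (_ : _ @^-1` _ = `]((a - c) / k)%R, ((b - c) / k)%R])%classic; last first.
      apply/seteqP; split=> x /=; rewrite !in_itv/= ltr_pdivrMr// ler_pdivlMr// => /andP[? ?];
        by apply/andP; split; nra.
    rewrite lebesgue_measure_itv/= lte_fin ltr_pdivlMr// divfK//.
    rewrite ltrBlDr subrK; case: ifPn => ab; last by rewrite mule0.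
    rewrite -!EFinD -EFinM gtr0_norm//; congr _%:E; field.
    by rewrite gt_eqF.
Qed.
End affine.

Section elementary_maps.
Variable R : realType.
Local Notation RM := (measurableTypeR R).
Local Notation mu := (@lebesgue_measure R).
Local Notation V3 := (RM * RM * RM)%type.
Local Open Scope ereal_scope.
Implicit Type F : V3 -> \bar R.

Lemma leb3E : @leb3 R = (@leb2 R \x mu). Proof. by []. Qed.

Lemma ge0_integral_leb3 F : measurable_fun setT F -> (forall p, 0 <= F p) ->
  \int[@leb3 R]_p F p = \int[mu]_x \int[mu]_y \int[mu]_z F (x, y, z).
Proof.
move=> mF F0.
have mG := measurable_fun_fubini_tonelli_F (m2 := lebesgue_measure) F mF F0.
have G0 p : 0 <= fubini_F lebesgue_measure F p by exact: integral_ge0.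
rewrite leb3E (fubini_tonelli1 F mF F0).
exact: (fubini_tonelli1 _ mG G0).
Qed.

(** Phrased with nonnegative integrands so that it is stable under composition without any
    integrability. The factor keeps its sign so that it can be matched with a determinant. *)
Definition scales_leb3 (T : V3 -> V3) (k : R) :=
  measurable_fun setT T /\
  forall F, measurable_fun setT F -> (forall p, 0 <= F p) ->
    (`|k|%R)%:E * \int[@leb3 R]_p F (T p) = \int[@leb3 R]_p F p.

Lemma scales_leb3_comp T S k l : scales_leb3 T k -> scales_leb3 S l ->
  scales_leb3 (T \o S) (l * k)%R.
Proof.
move=> [mT HT] [mS HS]; split; first exact: measurableT_comp.
move=> F mF F0; have mFT : measurable_fun setT (F \o T) by exact: measurableT_comp.
by rewrite -(HT F mF F0) -(HS (F \o T) mFT (fun p => F0 _)) muleA -EFinM normrM mulrC.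
Qed.

(** These maps generate all invertible linear maps: a swap is an instance of Tonelli's theorem, and
    [subst3] is an affine substitution in one variable. *)
Definition swap12 (p : V3) : V3 := (p.1.2, p.1.1, p.2).
Definition swap23 (p : V3) : V3 := (p.1.1, p.2, p.1.2).
Definition subst3 (a b c : R) (p : V3) : V3 :=
  (p.1.1, p.1.2, (a * p.1.1 + b * p.1.2 + c * p.2)%R).

Let m1 : measurable_fun setT (fun p : V3 => p.1.1).
Proof. exact: measurableT_comp. Qed.
Let m2 : measurable_fun setT (fun p : V3 => p.1.2).
Proof. exact: measurableT_comp. Qed.

Lemma scales_swap12 : scales_leb3 swap12 1.
Proof.
have ms : measurable_fun setT swap12.
  by apply: measurable_fun_pair => //; exact: measurable_fun_pair.
split=> // F mF F0.
have mFs : measurable_fun setT (fun p => F (swap12 p)) by exact: measurableT_comp.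
rewrite normr1 mul1e (ge0_integral_leb3 mFs (fun p => F0 _)) (ge0_integral_leb3 mF F0).
pose G := fubini_F mu F.
have -> : \int[mu]_x \int[mu]_y \int[mu]_z F (x, y, z) = \int[mu]_x \int[mu]_y G (x, y) by [].
rewrite (fubini_tonelli G)//; first exact: measurable_fun_fubini_tonelli_F.
by move=> p; exact: integral_ge0.
Qed.

Lemma scales_swap23 : scales_leb3 swap23 1.
Proof.
have ms : measurable_fun setT swap23.
  by apply: measurable_fun_pair => //; exact: measurable_fun_pair.
split=> // F mF F0.
have mFs : measurable_fun setT (fun p => F (swap23 p)) by exact: measurableT_comp.
rewrite normr1 mul1e (ge0_integral_leb3 mFs (fun p => F0 _)) (ge0_integral_leb3 mF F0).
apply: eq_integral => x _.
rewrite (fubini_tonelli (fun q : RM * RM => F (x, q.1, q.2)))//.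
apply: measurableT_comp => //; apply: measurable_fun_pair => //.
exact: measurable_fun_pair.
Qed.

Lemma scales_subst3 a b c : c != 0%R -> scales_leb3 (subst3 a b c) c.
Proof.
move=> c0.
have ms : measurable_fun setT (subst3 a b c).
  apply: measurable_fun_pair; first exact: measurable_fun_pair.
  by apply: measurable_funD; [apply: measurable_funD|]; apply: measurable_funM.
split=> // F mF F0.
have mG : measurable_fun setT (fun p => F (subst3 a b c p)) by exact: measurableT_comp.
rewrite leb3E (fubini_tonelli1 _ mG (fun p => F0 _)) (fubini_tonelli1 F mF F0).
rewrite -ge0_integralZl//;
  [|exact: measurable_fun_fubini_tonelli_F|by move=> p _; exact: integral_ge0].
apply: eq_integral => -[x y] _; rewrite /fubini_F/=.
rewrite -[RHS](ge0_integral_affine (a * x + b * y)%R c0)//.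
  by congr (_ * _); apply: eq_integral => z _; rewrite /subst3/= addrC.
apply: measurableT_comp => //.
Qed.
End elementary_maps.

Section linear_maps.
Variable R : realType.
Local Notation RM := (measurableTypeR R).
Local Notation mu := (@lebesgue_measure R).
Local Notation V3 := (RM * RM * RM)%type.

Lemma scales_leb3N (T : V3 -> V3) (k : R) : scales_leb3 T k -> scales_leb3 T (- k).
Proof. by rewrite /scales_leb3 normrN. Qed.

Definition lin3 (u v w : vec3 R) (p : V3) : V3 :=
  vadd (vadd (vscale p.1.1 u) (vscale p.1.2 v)) (vscale p.2 w).

Lemma lin3_swap12 u v w : lin3 u v w = lin3 v u w \o @swap12 R.
Proof. by apply/funext => p; congr (_, _, _) => /=; ring. Qed.

Lemma lin3_swap23 u v w : lin3 u v w = lin3 u w v \o @swap23 R.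
Proof. by apply/funext => p; congr (_, _, _) => /=; ring. Qed.

Let swap13 := @swap12 R \o @swap23 R \o @swap12 R.

Let scales_swap13 : scales_leb3 swap13 1.
Proof.
rewrite -[1](mulr1 1); apply: scales_leb3_comp (scales_swap12 R).
by rewrite -[1](mulr1 1); exact: scales_leb3_comp (scales_swap12 R) (scales_swap23 R).
Qed.

Let scales_subst1 (a b c : R) : a != 0 ->
  scales_leb3 (lin3 (a, 0, 0) (b, 1, 0) (c, 0, 1)) a.
Proof.
move=> a0.
rewrite (_ : lin3 _ _ _ = swap13 \o subst3 c b a \o swap13); last first.
  by apply/funext => p; congr (_, _, _) => /=; ring.
rewrite -[X in scales_leb3 _ X]mul1r -[X in _ * X]mulr1.
apply: scales_leb3_comp => //; apply: scales_leb3_comp => //.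
exact: scales_subst3.
Qed.

(** One elimination step: the second coordinate [b x + d y + f z] of the image replaces [y] as a
    variable, and [a - c b / d] is the remaining pivot. *)
Let scales_subst2 (a b c d e f : R) : d != 0 -> a * d - b * c != 0 ->
  scales_leb3 (lin3 (a, b, 0) (c, d, 0) (e, f, 1)) (a * d - b * c).
Proof.
move=> d0 abcd0.
rewrite (_ : lin3 _ _ _ =
  lin3 (a - c * b / d, 0, 0) (c / d, 1, 0) (e - c * f / d, 0, 1) \o
  (@swap23 R \o subst3 b f d \o @swap23 R)); last first.
  by apply/funext => p; congr (_, _, _) => /=; field.
rewrite (_ : a * d - b * c = (1 * (d * 1)) * (a - c * b / d)); last by field.
apply: scales_leb3_comp.
  apply: scales_subst1; rewrite (_ : _ - _ = (a * d - b * c) / d); last by field.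
  by rewrite mulf_neq0// invr_eq0.
apply: scales_leb3_comp (scales_swap23 R).
by apply: scales_leb3_comp; [exact: scales_swap23|exact: scales_subst3].
Qed.

Let scales_lin3_block (a b c d e f : R) : a * d - b * c != 0 ->
  scales_leb3 (lin3 (a, b, 0) (c, d, 0) (e, f, 1)) (a * d - b * c).
Proof.
move=> abcd0; have [d0|] := eqVneq d 0; last by move=> d0; exact: scales_subst2.
have b0 : b != 0 by apply: contraNneq abcd0 => ->; rewrite d0; apply/eqP; ring.
rewrite lin3_swap12 (_ : _ - _ = 1 * - (c * b - d * a)); last by ring.
apply: scales_leb3_comp (scales_swap12 R); apply: scales_leb3N.
apply: scales_subst2 => //; apply: contra_neq abcd0 => h.
by rewrite -[RHS]oppr0 -h; ring.
Qed.

(** With the third coordinate of the image as a variable in place of [z], the first two columns lose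
    their third entries; the determinant becomes [w3] times a 2 by 2 minor. *)
Let scales_lin3_pivot (u v w : vec3 R) : w.2 != 0 -> det3 u v w != 0 ->
  scales_leb3 (lin3 u v w) (det3 u v w).
Proof.
case: u v w => [[u1 u2] u3] [[v1 v2] v3] [[w1 w2] w3] /= w0 d0.
rewrite (_ : lin3 _ _ _ =
  lin3 (u1 - u3 * w1 / w3, u2 - u3 * w2 / w3, 0)
       (v1 - v3 * w1 / w3, v2 - v3 * w2 / w3, 0) (w1 / w3, w2 / w3, 1) \o
  subst3 u3 v3 w3); last first.
  by apply/funext => p; congr (_, _, _) => /=; field.
set k := (u1 - u3 * w1 / w3) * (v2 - v3 * w2 / w3) -
   (u2 - u3 * w2 / w3) * (v1 - v3 * w1 / w3).
have Dk : det3 (u1, u2, u3) (v1, v2, v3) (w1, w2, w3) = w3 * k.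
  by rewrite /det3/= /k; field.
rewrite Dk; apply: scales_leb3_comp; last exact: scales_subst3.
by apply: scales_lin3_block; apply: contraNneq d0; rewrite Dk /k => ->; rewrite mulr0.
Qed.

(** Gaussian elimination with pivoting: some third entry is nonzero, since otherwise the determinant
    vanishes, and swaps bring it into the last column. The sign change of an odd permutation is
    absorbed by [scales_leb3N]. *)
Lemma scales_lin3 (u v w : vec3 R) : det3 u v w != 0 ->
  scales_leb3 (lin3 u v w) (det3 u v w).
Proof.
move=> d0; have [w0|] := eqVneq w.2 0; last by move=> ?; exact: scales_lin3_pivot.
have [v0|v0] := eqVneq v.2 0; last first.
  rewrite lin3_swap23 (_ : det3 u v w = 1 * - det3 u w v); last first.
    by rewrite /det3; ring.
  apply: scales_leb3_comp (scales_swap23 R); apply: scales_leb3N.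
  apply: scales_lin3_pivot => //; apply: contra_neq d0 => h.
  by rewrite -[RHS]oppr0 -h /det3; ring.
have u0 : u.2 != 0.
  by apply: contraNneq d0 => h; apply/eqP; rewrite /det3 w0 v0 h; ring.
rewrite lin3_swap12 lin3_swap23 (_ : det3 u v w = 1 * (1 * det3 v w u)); last first.
  by rewrite /det3; ring.
apply: scales_leb3_comp (scales_swap12 R); apply: scales_leb3_comp (scales_swap23 R).
apply: scales_lin3_pivot => //; apply: contra_neq d0 => h.
by rewrite -h /det3; ring.
Qed.
End linear_maps.

Section signed_change.
Variable R : realType.
Local Notation RM := (measurableTypeR R).
Local Notation mu := (@lebesgue_measure R).
Local Notation V3 := (RM * RM * RM)%type.
Local Open Scope ereal_scope.

(** The nonnegative case is applied to the positive and the negative part; applied to [|g|], it also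
    transfers integrability to [g \o T]. *)
Lemma integral_scales_leb3 (T : V3 -> V3) (k : R) (g : V3 -> \bar R) : k != 0%R ->
  scales_leb3 T k -> (@leb2 R \x mu).-integrable setT g ->
  (@leb2 R \x mu).-integrable setT (g \o T) /\
  (`|k|%R)%:E * \int[@leb2 R \x mu]_p g (T p) = \int[@leb2 R \x mu]_p g p.
Proof.
move=> k0 [mT HT] ig.
have mg := measurable_int _ ig.
have k0' : (0 < `|k|)%R by rewrite normr_gt0.
have igT : (@leb2 R \x mu).-integrable setT (g \o T).
  apply/integrableP; split; first exact: measurableT_comp.
  move/integrableP : ig => [_].
  have mag : measurable_fun setT (fun p => `|g p|) by exact: measurableT_comp.
  rewrite -leb3E -(HT _ mag (fun p => abse_ge0 _)) /=.
  (* If the integral of [|g (T p)|] were infinite, multiplying it by [|k| > 0] would leave it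
     infinite. *)
  apply: contraTT; rewrite -!leNgt !leye_eq => /eqP->.
  by rewrite gt0_muley ?lte_fin.
split=> //.
rewrite integralE [in RHS]integralE.
have mp := measurable_funepos mg.
have mn := measurable_funeneg mg.
have Hp := HT _ mp (fun p => funepos_ge0 _ _).
have Hn := HT _ mn (fun p => funeneg_ge0 _ _).
rewrite leb3E in Hp Hn.
rewrite -Hp -Hn muleBr//; last exact: integrable_add_def igT.
have Ep : \int[@leb2 R \x mu]_p (fun p => g (T p))^\+ p = \int[@leb2 R \x mu]_p g^\+ (T p).
  by apply: eq_integral => p _; rewrite !funeposE.
have En : \int[@leb2 R \x mu]_p (fun p => g (T p))^\- p = \int[@leb2 R \x mu]_p g^\- (T p).
  by apply: eq_integral => p _; rewrite !funenegE.
by rewrite Ep En.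
Qed.
End signed_change.

(** * One- and two-dimensional integrals *)

Section one_variable_integrals.
Variable R : realType.
Local Notation RM := (measurableTypeR R).
Local Notation mu := (@lebesgue_measure R).

Lemma is_derive1_continuous (f : R -> R) (x df : R) : is_derive x 1 f df ->
  {for x, continuous f}.
Proof. by move=> [df1 _]; exact/differentiable_continuous/derivable1_diffP. Qed.

Lemma cvg_atan_affine (k c : R) : 0 < k ->
  (atan ((s + c) / k) @[s --> +oo] --> (pi / 2 : R)).
Proof.
move=> k0; apply: (cvg_comp (fun s => (s + c) / k) (@atan R)); last exact: cvgy_atan.
apply/cvgryPge => A; near=> s.
rewrite ler_pdivlMr// -lerBlDr.
by near: s; apply: nbhs_pinfty_ge; rewrite num_real.
Unshelve. all: by end_near. Qed.

(** For unit vectors at angle [a], the direction of [C + s B] turns from [C] towards [B] at the rate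
    [sin a / (1 + 2 s cos a + s^2)], so the total turn is [a]. The antiderivative comes from the
    square [(s + cos a)^2 + sin a ^2]. *)
Lemma integral_inv_quadratic (a : R) : 0 < a < pi ->
  (\int[mu]_(s in `[0%R, +oo[) ((1 + 2 * cos a * s + s ^+ 2)^-1)%:E = (a / sin a)%:E)%E.
Proof.
move=> /andP[a0 api].
have sa : 0 < sin a by apply: sin_gt0_pi; rewrite a0.
have sn0 : sin a != 0 by rewrite gt_eqF.
have qE (s : R) : 1 + 2 * cos a * s + s ^+ 2 = (s + cos a) ^+ 2 + sin a ^+ 2.
  by rewrite sin2cos2; ring.
have q0 (s : R) : 0 < 1 + 2 * cos a * s + s ^+ 2.
  by rewrite qE ltr_wpDl ?sqr_ge0// exprn_gt0.
pose F (s : R) := (sin a)^-1 * atan ((s + cos a) / sin a).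
have dF (s : R) : is_derive s 1 F (1 + 2 * cos a * s + s ^+ 2)^-1.
  have Hi : is_derive s 1 (fun s => (s + cos a) / sin a) (sin a)^-1.
    move: (cos a) (sin a) => c k.
    by apply: is_derive_eq; rewrite scaler0 add0r addr0 /GRing.scale /= mulr1.
  have H := is_derive1_comp (f := atan) (g := fun s => (s + cos a) / sin a)
    (is_derive1_atan _) Hi.
  have := is_deriveZ (sin a)^-1 H; rewrite /GRing.scale/=.
  congr is_derive; rewrite qE; field.
  by rewrite sn0 /= -qE gt_eqF.
have limF : F s @[s --> +oo] --> (sin a)^-1 * (pi / 2).
  by apply: cvgMl_tmp; exact: cvg_atan_affine.
rewrite (ge0_continuous_FTC2y _ _ limF) //.
- rewrite /F add0r -EFinB; congr _%:E.
  (* The lower limit contributes [atan (cot a) = pi / 2 - a], which lies in the range of [atan];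
     subtracted from [pi / 2] it leaves [a]. *)
  have -> : cos a / sin a = tan (pi / 2 - a).
    by rewrite /tan sinB cosB sin_pihalf cos_pihalf !mul1r !mul0r subr0 add0r.
  rewrite tanK ?in_itv/=; last by apply/andP; split; lra.
  by field.
- by move=> x _; rewrite invr_ge0 ltW.
- apply: continuous_subspaceT => x.
  have : derivable (fun s : R => 1 + 2 * cos a * s + s ^+ 2) x 1 by [].
  move=> /derivable1_diffP/differentiable_continuous cq.
  by apply: (@cvgV _ _ _ _ (fun s : R => 1 + 2 * cos a * s + s ^+ 2)) => //; rewrite gt_eqF.
- exact: cvg_at_right_filter (is_derive1_continuous (dF 0)).
- by move=> x _; rewrite derive1E; apply: derive_val.
Qed.

Lemma integral_radial_cone :
  (\int[mu]_(r in `[0%R, 1%R]) (r * (1 - r))%:E = (6^-1 : R)%:E)%E.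
Proof.
pose F (r : R) := r ^+ 2 / 2 - r ^+ 3 / 3.
have dF (r : R) : is_derive r 1 F (r * (1 - r)).
  by rewrite /F; apply: is_derive_eq; rewrite /GRing.scale/=; field.
rewrite (@continuous_FTC2 _ _ F)//.
- by rewrite -EFinB; congr _%:E; rewrite /F; field.
- apply: continuous_subspaceT => x.
  have : derivable (fun r : R => r * (1 - r)) x 1 by [].
  by move=> /derivable1_diffP/differentiable_continuous.
- split.
  + by move=> x _; have [] := dF x.
  + exact: cvg_at_right_filter (is_derive1_continuous (dF 0)).
  + exact: cvg_at_left_filter (is_derive1_continuous (dF 1)).
- by move=> x _; rewrite derive1E; apply: derive_val.
Qed.

Lemma integral_radial_ball :
  (\int[mu]_(r in `[0%R, 1%R]) (r * (2 * Num.sqrt (1 - r ^+ 2)))%:E = (2 / 3 : R)%:E)%E.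
Proof.
pose F (r : R) := - (2 / 3) * (1 - r ^+ 2) * Num.sqrt (1 - r ^+ 2).
have cq : continuous (fun r : R => Num.sqrt (1 - r ^+ 2)).
  move=> r; apply: (continuous_comp (f := fun r : R => 1 - r ^+ 2)); last exact: sqrt_continuous.
  have : derivable (fun r : R => 1 - r ^+ 2) r 1 by [].
  by move=> /derivable1_diffP/differentiable_continuous.
have cF : continuous F.
  move=> r; apply: cvgM; last exact: cq.
  have : derivable (fun r : R => - (2 / 3) * (1 - r ^+ 2)) r 1 by [].
  by move=> /derivable1_diffP/differentiable_continuous.
(* The chain rule through [Num.sqrt] breaks down at [r = 1], where its argument vanishes; continuity
   of [F] covers the endpoints. *)
have dF (r : R) : 0 < r < 1 -> is_derive r 1 F (r * (2 * Num.sqrt (1 - r ^+ 2))).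
  move=> /andP[r0 r1].
  have q0 : 0 < 1 - r ^+ 2 by rewrite subr_gt0 expr_lt1// ltW.
  have Hi : is_derive r 1 (fun r => 1 - r ^+ 2) (- (2 * r)).
    by apply: is_derive_eq; rewrite /GRing.scale/=; ring.
  have H := is_derive1_comp (f := Num.sqrt) (g := fun r => 1 - r ^+ 2)
    (is_derive1_sqrt q0) Hi.
  rewrite /F; apply: is_derive_eq.
  rewrite /GRing.scale/=.
  have s0 : Num.sqrt (1 - r ^+ 2) != 0 by rewrite gt_eqF// sqrtr_gt0.
  have := sqr_sqrtr (ltW q0).
  set t := Num.sqrt _ in s0 *.
  by move=> <-; field.
rewrite (@continuous_FTC2 _ _ F)//.
- by rewrite -EFinB; congr _%:E; rewrite /F expr1n subrr sqrtr0 expr0n/= subr0 sqrtr1; field.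
- apply: continuous_subspaceT => x; apply: (@cvgM _ _ _ _ (fun r : R => r)); first exact: cvg_id.
  by apply: cvgM; [exact: cvg_cst|exact: cq].
- split.
  + by move=> x; rewrite in_itv/= => /dF[].
  + exact: cvg_at_right_filter (cF 0).
  + exact: cvg_at_left_filter (cF 1).
- by move=> x; rewrite in_itv/= => /dF H; rewrite derive1E; apply: derive_val.
Qed.
End one_variable_integrals.

(** * Skew polar coordinates in the plane *)

Section planar.
Variable R : realType.
Local Notation RM := (measurableTypeR R).
Local Notation mu := (@lebesgue_measure R).

Lemma measurable_sqrt : measurable_fun setT (@Num.sqrt R).
Proof. by apply: continuous_measurable_fun; exact: sqrt_continuous. Qed.

Lemma integral_if_ge0 (f : RM -> R) :
  (\int[mu]_(s in `[0%R, +oo[) (f s)%:E = \int[mu]_s (if 0 <= s then f s else 0)%:E)%E.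
Proof.
rewrite integral_mkcond; apply: eq_integral => s _.
by rewrite patchE mem_setE in_itv/= andbT; case: ifP.
Qed.

(* Substitute [y = s x], then [r = x sqrt (1 + 2 c s + s^2)]. *)
Lemma integral_quadrant (c : R) (h : RM -> R) : -1 < c < 1 ->
  measurable_fun setT h -> (forall r, 0 <= h r) ->
  (\int[mu]_x \int[mu]_y
     (if (0 < x) && (0 <= y) then h (Num.sqrt (x ^+ 2 + 2 * c * x * y + y ^+ 2)) else 0)%:E =
   (\int[mu]_(s in `[0%R, +oo[) ((1 + 2 * c * s + s ^+ 2)^-1)%:E) *
   (\int[mu]_r (if 0 < r then r * h r else 0)%:E))%E.
Proof.
move=> /andP[c1 c2] mh h0.
have q0 (s : R) : 0 < 1 + 2 * c * s + s ^+ 2.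
  have -> : 1 + 2 * c * s + s ^+ 2 = (s + c) ^+ 2 + (1 - c ^+ 2) by ring.
  by rewrite ltr_wpDl ?sqr_ge0//; nra.
pose rho (s : R) := Num.sqrt (1 + 2 * c * s + s ^+ 2).
have rho0 s : 0 < rho s by rewrite sqrtr_gt0.
have rho2 s : rho s ^+ 2 = 1 + 2 * c * s + s ^+ 2 by rewrite sqr_sqrtr// ltW.
have mrho : measurable_fun setT (rho : RM -> RM).
  apply: measurableT_comp; first exact: measurable_sqrt.
  apply: measurable_funD; last exact: measurable_funX.
  by apply: measurable_funD => //; apply: measurable_funM.
pose G (p : RM * RM) : \bar R :=
  (if (0 < p.1) && (0 <= p.2) then p.1 * h (p.1 * rho p.2) else 0)%:E.
have mG : measurable_fun setT G.
  apply/measurable_EFinP; apply: measurable_fun_ifT => //.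
    by apply: measurable_and; [exact: measurable_fun_ltr|exact: measurable_fun_ler].
  apply: measurable_funM => //; apply: measurableT_comp => //.
  by apply: measurable_funM => //; apply: measurableT_comp.
have G0 p : (0 <= G p)%E.
  by rewrite lee_fin; case: ifP => // /andP[x0 _]; rewrite mulr_ge0// ltW.
transitivity (\int[mu]_x \int[mu]_y G (x, y))%E.
  (* Inner substitution [y = s x] for fixed [x > 0]; its Jacobian is the factor [x] in [G]. *)
  apply: eq_integral => x _; have [x0|x0] := ltP 0 x; last first.
    by apply: eq_integral => y _; rewrite /G/= ltNge x0.
  pose G1 (y : RM) : \bar R :=
    (if 0 <= y then h (Num.sqrt (x ^+ 2 + 2 * c * x * y + y ^+ 2)) else 0)%:E.
  have mG1 : measurable_fun setT G1.
    apply/measurable_EFinP; apply: measurable_fun_ifT => //.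
      exact: measurable_fun_ler.
    apply: measurableT_comp => //; apply: measurableT_comp; first exact: measurable_sqrt.
    apply: measurable_funD; last exact: measurable_funX.
    by apply: measurable_funD => //; apply: measurable_funM.
  have G10 y : (0 <= G1 y)%E by rewrite lee_fin; case: ifP.
  transitivity (\int[mu]_y G1 y)%E; first by apply: eq_integral => y _; rewrite /G1.
  have xn0 : x != 0 by rewrite gt_eqF.
  rewrite -(ge0_integral_affine 0 xn0 mG1 G10).
  have mG1x : measurable_fun setT (fun y : RM => G1 (x * y + 0)).
    exact: measurableT_comp mG1 (measurable_affine x 0).
  rewrite -(ge0_integralZl lebesgue_measure measurableT mG1x (fun y _ => G10 _))//.
  apply: eq_integral => y _; rewrite /G /G1/= x0/= addr0 pmulr_rge0// gtr0_norm// -EFinM.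
  congr _%:E; case: ifP => y0; last by rewrite mulr0.
  rewrite (_ : _ + _ = x ^+ 2 * (1 + 2 * c * y + y ^+ 2)); last by ring.
  by rewrite sqrtrM ?sqr_ge0// sqrtr_sqr gtr0_norm.
rewrite (fubini_tonelli G mG G0) integral_if_ge0.
pose H (r : RM) : \bar R := (if 0 < r then r * h r else 0)%:E.
have mH : measurable_fun setT H.
  apply/measurable_EFinP; apply: measurable_fun_ifT => //; first exact: measurable_fun_ltr.
  exact: measurable_funM.
have H0 r : (0 <= H r)%E by rewrite lee_fin; case: ifP => // r0; rewrite mulr_ge0// ltW.
have cK : continuous (fun s : R => (1 + 2 * c * s + s ^+ 2)^-1).
  move=> s; have : derivable (fun s : R => 1 + 2 * c * s + s ^+ 2) s 1 by [].
  move=> /derivable1_diffP/differentiable_continuous cq.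
  by apply: (@cvgV _ _ _ _ (fun s : R => 1 + 2 * c * s + s ^+ 2)) => //; rewrite gt_eqF.
have K0 (s : R) : 0 <= (if 0 <= s then (1 + 2 * c * s + s ^+ 2)^-1 else 0).
  by case: ifP => // _; rewrite invr_ge0 ltW.
rewrite -/H -ge0_integralZr//; last 3 first.
- apply/measurable_EFinP; apply: measurable_fun_ifT => //; first exact: measurable_fun_ler.
  exact: continuous_measurable_fun.
- by move=> s _; rewrite lee_fin.
- by apply: integral_ge0 => r _; exact: H0.
apply: eq_integral => s _; have [s0|s0] := leP 0 s; last first.
  rewrite mul0e; apply: integral0_eq => x _.
  by rewrite /G/= leNgt s0 andbF.
have rn0 : rho s != 0 by rewrite gt_eqF.
rewrite -(ge0_integral_affine 0 rn0 mH H0).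
have mHs : measurable_fun setT (fun x : RM => H (rho s * x + 0)).
  exact: measurableT_comp mH (measurable_affine (rho s) 0).
(* For fixed [s], the substitution [r = x rho s] turns [x dx] into [r dr / rho s ^2], which
   separates the variables. *)
rewrite muleA -EFinM gtr0_norm// -rho2.
have c0 : (0 <= (rho s ^- 2 * rho s)%:E)%E by rewrite lee_fin mulr_ge0 ?invr_ge0 ?sqr_ge0// ltW.
rewrite -(ge0_integralZl lebesgue_measure measurableT mHs (fun x _ => H0 _) c0).
apply: eq_integral => x _; rewrite /G /H/= addr0 s0 andbT pmulr_rgt0// -EFinM; congr _%:E.
case: ifP => x0; last by rewrite mulr0.
rewrite (mulrC x (rho s)); field.
by rewrite gt_eqF.
Qed.
End planar.

(** * The derivative of the norm along a line *)

Section line.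
Variable R : realType.
Local Notation RM := (measurableTypeR R).
Local Notation mu := (@lebesgue_measure R).

Lemma integral_if_itv (P : pred R) (f : RM -> R) (a b : R) :
  (forall z, P z = (a <= z <= b)) ->
  (\int[mu]_z (if P z then f z else 0)%:E = \int[mu]_(z in `[a, b]) (f z)%:E)%E.
Proof.
move=> PE; rewrite [RHS]integral_mkcond; apply: eq_integral => z _.
by rewrite patchE mem_setE in_itv/= PE; case: ifP.
Qed.

(** The integrand is the derivative of the square root; [d ^+ 2 < q] means that the line misses the
    origin, so the norm is differentiable all along it. *)
Lemma integral_derive_norm_itv (d q a b : R) : d ^+ 2 < q -> a <= b ->
  (\int[mu]_(z in `[a, b]) ((z + d) / Num.sqrt (z ^+ 2 + 2 * d * z + q))%:E =
   (Num.sqrt (b ^+ 2 + 2 * d * b + q) - Num.sqrt (a ^+ 2 + 2 * d * a + q))%:E)%E.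
Proof.
move=> dq; rewrite le_eqVlt => /predU1P[->|ab].
  by rewrite set_itv1 integral_set1 subrr.
pose Q (z : R) := z ^+ 2 + 2 * d * z + q.
pose N (z : R) := Num.sqrt (Q z).
have Q0 z : 0 < Q z.
  have -> : Q z = (z + d) ^+ 2 + (q - d ^+ 2) by rewrite /Q; ring.
  by rewrite ltr_wpDl ?sqr_ge0// subr_gt0.
have N0 z : N z != 0 by rewrite gt_eqF// sqrtr_gt0.
have dQ (z : R) : is_derive z 1 Q (2 * (z + d)).
  by rewrite /Q; apply: is_derive_eq; rewrite /GRing.scale/=; ring.
have dN (z : R) : is_derive z 1 N ((z + d) / N z).
  have := is_derive1_comp (is_derive1_sqrt (Q0 z)) (dQ z).
  by congr is_derive; rewrite -/(N z); field.
have cN : continuous N.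
  by move=> z; have [/derivable1_diffP/differentiable_continuous] := dN z.
rewrite (@continuous_FTC2 _ _ N)//.
- apply: continuous_subspaceT => z.
  have : derivable (fun r : R => r + d) z 1 by [].
  move=> /derivable1_diffP/differentiable_continuous c1.
  by apply: (@cvgM _ _ _ _ (fun r => r + d)) => //; exact: (@cvgV _ _ _ _ N _ (N0 z) (cN z)).
- split=> //.
  + exact: cvg_at_right_filter (cN a).
  + exact: cvg_at_left_filter (cN b).
- by move=> x _; rewrite derive1E; apply: derive_val.
Qed.

(* Here [z ^+ 2 + 2 * d * z + q] is [|p + z A|^2] for a unit vector [A], with [d = p . A] and
   [q = |p|^2]. If [1 < q], the half-line that meets the ball enters and leaves it through
   the sphere, so it contributes 1 - 1 = 0. *)
Lemma integral_derive_norm_ball (d q : R) : d ^+ 2 < q ->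
  (\int[mu]_z (if (0 <= z)%R && (z ^+ 2 + 2 * d * z + q <= 1)%R
     then (z + d) / Num.sqrt (z ^+ 2 + 2 * d * z + q) else 0)%:E =
   (Num.max 0 (1 - Num.sqrt q))%:E)%E.
Proof.
move=> dq.
have q0 : 0 < q by rewrite (le_lt_trans _ dq)// sqr_ge0.
have max0 : 1 < q -> Num.max 0 (1 - Num.sqrt q) = 0.
  move=> q1; apply/max_idPl; rewrite subr_le0.
  by rewrite -[leLHS]sqrtr1 ler_sqrt// ltW.
(* A quarter of the discriminant of [z^2 + 2 d z + q - 1]: if it is negative, the line misses the
   ball; otherwise its root [e] is half the chord. *)
have [D0|D0] := ltP (d ^+ 2 + 1 - q) 0.
  rewrite max0; last by have := sqr_ge0 d; lra.
  apply: integral0_eq => z _; rewrite [X in if _ && X then _ else _](_ : _ = false) ?andbF//.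
  by apply/negbTE; rewrite -ltNge; have := sqr_ge0 (z + d); nra.
pose e := Num.sqrt (d ^+ 2 + 1 - q).
have e0 : 0 <= e by exact: sqrtr_ge0.
have e2 : e ^+ 2 = d ^+ 2 + 1 - q by rewrite sqr_sqrtr.
have condE z : (z ^+ 2 + 2 * d * z + q <= 1) = (- d - e <= z <= - d + e).
  have -> : (z ^+ 2 + 2 * d * z + q <= 1) = ((z + d) ^+ 2 <= e ^+ 2).
    by rewrite e2; apply/idP/idP => ?; lra.
  rewrite -(real_normK (num_real (z + d))) ler_sqr ?nnegrE//.
  rewrite ler_norml; apply/idP/idP => /andP[? ?]; apply/andP; split; lra.
have rootp : (- d + e) ^+ 2 + 2 * d * (- d + e) + q = 1.
  by rewrite (_ : _ + _ = e ^+ 2 - d ^+ 2 + q); [rewrite e2|]; ring.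
have rootm : (- d - e) ^+ 2 + 2 * d * (- d - e) + q = 1.
  by rewrite (_ : _ + _ = e ^+ 2 - d ^+ 2 + q); [rewrite e2|]; ring.
have [q1|q1] := leP q 1.
  rewrite (@integral_if_itv _ _ 0 (- d + e)) /=; last first.
    move=> z; rewrite condE; apply/idP/idP => [/and3P[? ? ?]|/andP[? ?]].
      by apply/andP.
    apply/and3P; split => //; nra.
  rewrite integral_derive_norm_itv//; last by nra.
  rewrite rootp sqrtr1 expr0n/= mulr0 !add0r; congr _%:E; apply/esym/max_idPr.
  by rewrite subr_ge0 -[leRHS]sqrtr1 ler_sqrt.
(* Since [1 < q] gives [e < |d|], both roots have the sign of [- d]: the half-line contains either
   nothing of the chord or all of it. *)
rewrite max0//; have [d0|d0] := leP 0 d.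
  apply: integral0_eq => z _; case: ifPn => // /andP[z0]; rewrite condE => /andP[_ ze].
  by exfalso; nra.
rewrite (@integral_if_itv _ _ (- d - e) (- d + e)) /=; last first.
  move=> z; rewrite condE; apply/idP/idP => [/andP[]//|/[dup] /andP[? ?] ->].
  by rewrite andbT; nra.
rewrite integral_derive_norm_itv//; last by lra.
by rewrite rootp rootm subrr.
Qed.
End line.

(** * The unit ball *)

Section ball.
Variable R : realType.
Local Notation RM := (measurableTypeR R).
Local Notation mu := (@lebesgue_measure R).
Local Open Scope ereal_scope.

(** Octants and cones come with weak inequalities, whereas the substitution [y = s x] needs [0 < x];
    the point 0 is negligible. *)
Lemma integral_if_gt0 (f : RM -> \bar R) : measurable_fun setT f ->
  \int[mu]_x (if (0 < x)%R then f x else 0) = \int[mu]_x (if (0 <= x)%R then f x else 0).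
Proof.
move=> mf.
transitivity (\int[mu]_(x in `]0%R, +oo[) f x).
  rewrite [RHS]integral_mkcond; apply: eq_integral => x _.
  by rewrite patchE mem_setE in_itv/= andbT.
rewrite integral_itv_obnd_cbnd; last exact: measurable_funTS.
rewrite integral_mkcond; apply: eq_integral => x _.
by rewrite patchE mem_setE in_itv/= andbT.
Qed.

Lemma ge0_integral_even (f : RM -> \bar R) : measurable_fun setT f ->
  (forall x, 0 <= f x) -> (forall x, f (- x)%R = f x) ->
  \int[mu]_x f x = 2%:E * \int[mu]_x (if (0 < x)%R then f x else 0).
Proof.
move=> mf f0 fN.
have mgt : measurable_fun setT (fun x : RM => if (0 < x)%R then f x else 0).
  by apply: measurable_fun_ifT => //; exact: measurable_fun_ltr.
have mle : measurable_fun setT (fun x : RM => if (0 <= x)%R then f x else 0).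
  by apply: measurable_fun_ifT => //; exact: measurable_fun_ler.
have mle' : measurable_fun setT (fun x : RM => if (x <= 0)%R then f x else 0).
  by apply: measurable_fun_ifT => //; exact: measurable_fun_ler.
transitivity (\int[mu]_x ((if (0 < x)%R then f x else 0) + (if (x <= 0)%R then f x else 0))).
  by apply: eq_integral => x _; case: ltP => _; rewrite ?adde0 ?add0e.
rewrite ge0_integralD//; [|by move=> x _; case: ifP|by move=> x _; case: ifP].
rewrite mule_natl mule2n; congr +%E.
have N10 : (- 1 : R)%R != 0%R by rewrite oppr_eq0 oner_eq0.
have ge0 x : 0 <= (if (0 <= x)%R then f x else 0) by case: ifP.
rewrite integral_if_gt0// -(ge0_integral_affine 0 N10 mle ge0) normrN1 mul1e.
by apply: eq_integral => x _; rewrite addr0 mulN1r oppr_ge0 fN.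
Qed.
Local Close Scope ereal_scope.

Lemma integral_disk_column (q : R) :
  (\int[mu]_z (if (q + z ^+ 2 <= 1)%R then 1 else 0)%:E = (2 * Num.sqrt (1 - q))%:E)%E.
Proof.
have [q1|q1] := leP q 1; last first.
  (* Outside the disk the column is empty, in agreement with the value 0 of [Num.sqrt] at negative
     arguments. *)
  rewrite ler0_sqrtr ?mulr0; last by rewrite subr_le0 ltW.
  apply: integral0_eq => z _; case: ifPn => // h.
  by exfalso; have := sqr_ge0 z; lra.
have s0 := sqrtr_ge0 (1 - q).
have s2 : Num.sqrt (1 - q) ^+ 2 = 1 - q by rewrite sqr_sqrtr// subr_ge0.
rewrite (@integral_if_itv _ _ (cst 1) (- Num.sqrt (1 - q)) (Num.sqrt (1 - q))).
  transitivity (1%:E * mu `[(- Num.sqrt (1 - q))%R, Num.sqrt (1 - q)%R]%classic)%E.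
    by rewrite -(integral_cst mu (measurable_itv _) 1%:E).
  rewrite lebesgue_measure_itv/= mul1e lte_fin.
  case: ifPn => [_|]; first by rewrite -EFinB; congr _%:E; ring.
  rewrite -leNgt => h; congr _%:E; lra.
move=> z; rewrite -ler_norml -(ler_sqr (x := `|z|)) ?nnegrE// real_normK ?num_real// s2.
by apply/idP/idP => ?; lra.
Qed.

Local Notation V3 := (RM * RM * RM)%type.

Lemma measurable_dot (f g : V3 -> vec3 R) :
  measurable_fun setT (f : V3 -> V3) -> measurable_fun setT (g : V3 -> V3) ->
  measurable_fun setT (fun p => dot (f p) (g p)).
Proof.
move=> mf mg.
have m1 := measurableT_comp (measurable_fst : measurable_fun setT (fst : RM * RM -> RM))
  (measurable_fst : measurable_fun setT (fst : V3 -> RM * RM)).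
have m2 := measurableT_comp (measurable_snd : measurable_fun setT (snd : RM * RM -> RM))
  (measurable_fst : measurable_fun setT (fst : V3 -> RM * RM)).
have m3 := measurable_snd : measurable_fun setT (snd : V3 -> RM).
by apply: measurable_funD; [apply: measurable_funD|]; apply: measurable_funM;
  [exact: measurableT_comp m1 mf|exact: measurableT_comp m1 mg|
   exact: measurableT_comp m2 mf|exact: measurableT_comp m2 mg|
   exact: measurableT_comp m3 mf|exact: measurableT_comp m3 mg].
Qed.

Lemma measurable_dot_self : measurable_fun setT (fun p : V3 => dot p p).
Proof. exact: (measurable_dot (f := fun p => p) (g := fun p => p)). Qed.

Lemma vnorm_le1 (p : vec3 R) : (vnorm p <= 1) = (dot p p <= 1).
Proof. by rewrite -[in LHS](sqrtr1 R) ler_sqrt. Qed.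

Lemma leb3_ball3E :
  leb3 (@ball3 R) = (\int[@leb3 R]_p (if dot p p <= 1 then 1 else 0)%:E)%E.
Proof.
have ballE : @ball3 R = [set p : V3 | dot p p <= 1].
  by apply/seteqP; split=> p; rewrite /ball3/= vnorm_le1.
have mB : measurable (@ball3 R : set V3).
  rewrite ballE -[X in measurable X]setTI; apply: measurable_fun_le => //.
  exact: measurable_dot_self.
transitivity (@leb3 R ((@ball3 R : set V3) `&` setT)); first by rewrite setIT.
rewrite leb3E -integral_indic//.
apply: eq_integral => p _; rewrite indicE ballE; congr _%:E.
by case: ifPn => Qp; [rewrite mem_set|rewrite memNset//; exact/negP].
Qed.

(** Columns have height [2 sqrt (1 - r^2)]; by evenness in [x] and [y] the disk amounts to four
    quadrants, and the quadrant formula with [c = 0] gives [4 * (pi / 2) * (2 / 3)]. The vanishing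
    term [2 * 0 * x * y] is kept to match that formula. *)
Lemma leb3_ball3 : leb3 (@ball3 R) = (4 * pi / 3)%:E.
Proof.
pose F (p : V3) : \bar R := (if dot p p <= 1 then 1 else 0)%:E.
have mF : measurable_fun setT F.
  apply/measurable_EFinP; apply: measurable_fun_ifT => //.
  by apply: measurable_fun_ler => //; exact: measurable_dot_self.
have F0 p : (0 <= F p)%E by rewrite lee_fin; case: ifP.
pose h (r : RM) : R := 2 * Num.sqrt (1 - r ^+ 2).
have h0 r : 0 <= h r by rewrite mulr_ge0// sqrtr_ge0.
have mh : measurable_fun setT h.
  apply: measurable_funM => //; apply: measurableT_comp; first exact: measurable_sqrt.
  by apply: measurable_funD => //; apply: measurableT_comp => //; exact: measurable_funX.
rewrite leb3_ball3E.
rewrite (ge0_integral_leb3 mF F0).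
pose H (p : RM * RM) : \bar R := (h (Num.sqrt (p.1 ^+ 2 + 2 * 0 * p.1 * p.2 + p.2 ^+ 2)))%:E.
have mH : measurable_fun setT H.
  apply/measurable_EFinP/measurableT_comp => //.
  apply: measurableT_comp; first exact: measurable_sqrt.
  apply: measurable_funD; last exact: measurable_funX.
  apply: measurable_funD; first exact: measurable_funX.
  by apply: measurable_funM => //; exact: measurable_funM.
have H0 p : (0 <= H p)%E by rewrite lee_fin.
transitivity (\int[mu]_x \int[mu]_y H (x, y))%E.
  apply: eq_integral => x _; apply: eq_integral => y _.
  rewrite [LHS](integral_disk_column (x * x + y * y)) -!expr2 /H /h/= mulr0 !mul0r addr0.
  rewrite sqr_sqrtr//.
  by rewrite addr_ge0// sqr_ge0.
have HNx x y : H (- x, y) = H (x, y) by rewrite /H/= sqrrN mulr0 !mul0r.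
have HNy x y : H (x, - y) = H (x, y) by rewrite /H/= sqrrN mulr0 !mul0r.
have mHx := measurable_fun_fubini_tonelli_F (m2 := lebesgue_measure) H mH H0.
rewrite (ge0_integral_even mHx); last 2 first.
- by move=> x; exact: integral_ge0.
- by move=> x; apply: eq_integral => y _; exact: HNx.
transitivity (2%:E * (2%:E * \int[mu]_x \int[mu]_y
     (if (0 < x) && (0 <= y) then h (Num.sqrt (x ^+ 2 + 2 * 0 * x * y + y ^+ 2)) else 0)%:E))%E.
  congr *%E.
  pose K (p : RM * RM) : \bar R := (if (0 < p.1) && (0 <= p.2)
    then h (Num.sqrt (p.1 ^+ 2 + 2 * 0 * p.1 * p.2 + p.2 ^+ 2)) else 0)%:E.
  have mK : measurable_fun setT K.
    apply/measurable_EFinP; apply: measurable_fun_ifT; last exact: measurable_cst.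
      by apply: measurable_and; [exact: measurable_fun_ltr|exact: measurable_fun_ler].
    exact/measurable_EFinP.
  have K0 p : (0 <= K p)%E by rewrite lee_fin; case: ifP.
  have mKx := measurable_fun_fubini_tonelli_F (m2 := lebesgue_measure) K mK K0.
  have IK0 (x : RM) : setT x -> (0 <= fubini_F lebesgue_measure K x)%E.
    by move=> _; exact: integral_ge0.
  have two0 : (0 <= 2%:E :> \bar R)%E by rewrite lee_fin.
  rewrite -[RHS](ge0_integralZl lebesgue_measure measurableT mKx IK0 two0).
  apply: eq_integral => x _; rewrite /fubini_F /K/=; case: ifPn => x0; last first.
    by rewrite integral0_eq ?mule0// => y _.
  have mHy : measurable_fun setT (fun y : RM => H (x, y)) by exact: measurableT_comp.
  rewrite [LHS](ge0_integral_even mHy (fun y => H0 _) (HNy x)).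
  congr *%E; rewrite integral_if_gt0//.
  by apply: eq_integral => y _; rewrite /H/=; case: ifP.
rewrite integral_quadrant//; last by rewrite ltrN10 ltr01.
have -> : (\int[mu]_(s in `[0%R, +oo[) ((1 + 2 * 0 * s + s ^+ 2)^-1)%:E = (pi / 2)%:E)%E.
  have /integral_inv_quadratic : 0 < (pi / 2 : R) < pi by have := pi_gt0 R; lra.
  by rewrite cos_pihalf sin_pihalf divr1.
have -> : (\int[mu]_r (if 0 < r then r * h r else 0)%:E = (2 / 3)%:E)%E.
  rewrite -integral_radial_ball -(@integral_if_itv _ (fun r => 0 <= r <= 1) _ 0 1)//.
  apply: eq_integral => r _; congr _%:E.
  have [r0|r0|<-] := ltgtP 0 r => //=; last by rewrite mul0r if_same.
  case: ifPn => //; rewrite -ltNge /h => r1.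
  by rewrite ler0_sqrtr ?mulr0// subr_le0 ltW// expr_gt1// ltW.
by rewrite -!EFinM; congr _%:E; field.
Qed.
End ball.

(** * The cone over a spherical triangle *)

Section vectors.
Variable R : realType.
Implicit Types u v w : vec3 R.

Lemma dotC u v : dot u v = dot v u.
Proof. by rewrite /dot; ring. Qed.

Lemma dot_ge0 u : 0 <= dot u u.
Proof. by rewrite /dot -!expr2 !addr_ge0// sqr_ge0. Qed.

Lemma dot_eq0 u : dot u u = 0 -> u = (0, 0, 0).
Proof.
case: u => [[x y] z]; rewrite /dot/= -!expr2 => /eqP.
rewrite paddr_eq0 ?addr_ge0 ?sqr_ge0// paddr_eq0 ?sqr_ge0// !sqrf_eq0.
by move=> /andP[/andP[/eqP-> /eqP->] /eqP->].
Qed.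

Lemma sqr_vnorm u : vnorm u ^+ 2 = dot u u.
Proof. by rewrite sqr_sqrtr// dot_ge0. Qed.

Lemma vnorm_gt0 u : u <> origin3 R -> 0 < vnorm u.
Proof.
move=> u0; rewrite sqrtr_gt0 lt_neqAle dot_ge0 andbT eq_sym.
by apply/eqP => /dot_eq0.
Qed.

(** Lagrange's identity: the defect is the squared norm of the cross product. *)
Lemma dot_sqr_le u v : dot u v ^+ 2 <= dot u u * dot v v.
Proof.
rewrite -subr_ge0.
have -> : dot u u * dot v v - dot u v ^+ 2 =
  (u.1.1 * v.1.2 - u.1.2 * v.1.1) ^+ 2 + (u.1.1 * v.2 - u.2 * v.1.1) ^+ 2
  + (u.1.2 * v.2 - u.2 * v.1.2) ^+ 2 by rewrite /dot; ring.
by rewrite !addr_ge0// sqr_ge0.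
Qed.

(** The right-hand side is the expanded Gram determinant. *)
Lemma sqr_det3 u v w : det3 u v w ^+ 2 =
  dot u u * dot v v * dot w w + 2 * dot u v * dot v w * dot w u
  - dot u u * dot v w ^+ 2 - dot v v * dot w u ^+ 2 - dot w w * dot u v ^+ 2.
Proof. by rewrite /det3 /dot; ring. Qed.

Lemma det3_lin3 u v w (x y z : R) :
  let X := lin3 u v w (x, y, z) in
  [/\ det3 X v w = x * det3 u v w, det3 u X w = y * det3 u v w &
      det3 u v X = z * det3 u v w].
Proof. by split; rewrite /det3/=; ring. Qed.

Lemma cramer3 u v w (X : vec3 R) : det3 u v w != 0 ->
  X = lin3 u v w (det3 X v w / det3 u v w, det3 u X w / det3 u v w, det3 u v X / det3 u v w).
Proof.
move=> d0; rewrite [LHS]surjective_pairing [X.1 in LHS]surjective_pairing.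
by congr (_, _, _); rewrite /=; move: d0; rewrite /det3 => d0; field.
Qed.

(* Strict Cauchy-Schwarz: [u x + v y] does not lie on the line spanned by [w]. *)
Lemma dot_sqr_lt u v w (x y : R) : dot w w = 1 -> det3 u v w != 0 -> 0 < x ->
  dot (lin3 u v w (x, y, 0)) w ^+ 2 < dot (lin3 u v w (x, y, 0)) (lin3 u v w (x, y, 0)).
Proof.
move=> w1 d0 x0; set p := lin3 _ _ _ _; set d := dot p w.
rewrite -subr_gt0.
(* Removing the projection onto [w] changes only the third coordinate, so the vector keeps its first
   coordinate [x > 0] and is nonzero. *)
have -> : dot p p - d ^+ 2 = dot (lin3 u v w (x, y, - d)) (lin3 u v w (x, y, - d)).
  transitivity (dot p p - 2 * d * dot p w + d ^+ 2 * dot w w).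
    by rewrite w1 -/d; ring.
  by rewrite /p /dot/=; ring.
rewrite lt_neqAle dot_ge0 andbT eq_sym; apply/eqP => /dot_eq0 e.
have [+ _ _] := det3_lin3 u v w x y (- d); rewrite e.
rewrite (_ : det3 _ _ _ = 0); last by rewrite /det3/=; ring.
by move=> /esym/eqP; rewrite mulf_eq0 (negbTE d0) orbF gt_eqF.
Qed.

(** The spherical Pythagorean theorem [cos c = cos a cos b]. *)
Lemma sph_angle_pihalf_dot (A B C : vec3 R) : dot C C = 1 ->
  sph_angle C A B = pi / 2 -> dot A B = dot A C * dot B C.
Proof.
move=> C1; rewrite /sph_angle.
set u := tangent_at C A; set v := tangent_at C B => uv.
have -> : dot A B = dot u v + dot A C * dot B C.
  have -> : dot u v = dot A B - dot A C * dot B C - dot B C * dot A C + dot A C * dot B C * dot C C.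
    by rewrite /u /v /tangent_at /dot/=; ring.
  by rewrite C1; ring.
suff -> : dot u v = 0 by rewrite add0r.
have := dot_sqr_le u v; rewrite -!sqr_vnorm -exprMn.
set n := vnorm u * vnorm v in uv *.
have n0 : 0 <= n by rewrite mulr_ge0// sqrtr_ge0.
(* If a tangent vector vanishes, the angle is only a default value, but Cauchy-Schwarz still forces
   [dot u v = 0]. Otherwise it puts the quotient in [[-1, 1]], where [cos] inverts [acos]. *)
move=> le; have [nz|nn0] := eqVneq n 0.
  by move: le; rewrite nz expr0n/= => le; apply/eqP; rewrite -sqrf_eq0 eq_le le sqr_ge0.
have npos : 0 < n by rewrite lt_neqAle eq_sym nn0.
have r1 : -1 <= dot u v / n <= 1.
  rewrite -ler_norml normrM normfV (gtr0_norm npos) ler_pdivrMr// mul1r.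
  by rewrite -ler_sqr ?nnegrE// real_normK ?num_real.
have /acosK : dot u v / n \in `[-1, 1] by rewrite in_itv.
rewrite uv cos_pihalf => /esym/eqP; rewrite mulf_eq0 invr_eq0 (negbTE nn0) orbF.
by move/eqP.
Qed.
End vectors.

Section triangle.
Variable R : realType.
Local Notation RM := (measurableTypeR R).
Local Notation mu := (@lebesgue_measure R).
Local Notation V3 := (RM * RM * RM)%type.
Variables A B C : vec3 R.
Hypothesis A1 : dot A A = 1.
Let D := det3 C B A.
Hypothesis D0 : D != 0.

(* By Cramer's rule the three quotients are the coordinates of [X] in the basis [C, B, A]. *)
Definition cone_integrand (X : V3) : R :=
  if [&& 0 <= det3 X B A / D, 0 <= det3 C X A / D, 0 <= det3 C B X / D & dot X X <= 1]
  then dot X A / vnorm X else 0.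

(** Coordinates in the basis keep their signs under positive scaling, so the condition can be read
    on [X] itself; dividing by [D] makes it independent of the orientation. *)
Lemma radproj_sph_triangle (X : vec3 R) : X <> origin3 R ->
  sph_triangle A B C (radproj X) <->
  [/\ 0 <= det3 X B A / D, 0 <= det3 C X A / D & 0 <= det3 C B X / D].
Proof.
move=> X0; have n0 := vnorm_gt0 X0; have nn0 : vnorm X != 0 by rewrite gt_eqF.
split=> [[_ [al [be [ga [al0 [be0 [ga0 e]]]]]]]|[x0 y0 z0]].
  have -> : X = lin3 C B A (vnorm X * ga, vnorm X * be, vnorm X * al).
    have -> : lin3 C B A (vnorm X * ga, vnorm X * be, vnorm X * al) =
        vscale (vnorm X) (radproj X).
      by rewrite e; congr (_, _, _) => /=; ring.
    case: X {X0 e n0} nn0 => [[X1 X2] X3] nn0.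
    by rewrite /radproj /vscale/= !mulrA !divff// !mul1r.
  have [-> -> ->] := det3_lin3 C B A (vnorm X * ga) (vnorm X * be) (vnorm X * al).
  by rewrite -/D !mulfK//; split; rewrite mulr_ge0// ltW.
split.
  have e : dot (radproj X) (radproj X) = (vnorm X)^-1 ^+ 2 * dot X X.
    by rewrite /radproj /dot/=; ring.
  by rewrite /sphere2/= e -sqr_vnorm -exprMn mulVf// expr1n.
exists (det3 C B X / D / vnorm X), (det3 C X A / D / vnorm X), (det3 X B A / D / vnorm X).
do 3 (split; first by rewrite divr_ge0// ltW).
rewrite /radproj [X in vscale _ X](cramer3 X D0) -/D.
by congr (_, _, _) => /=; ring.
Qed.

Lemma cone_integrandE (X : V3) :
  ((fun x : V3 => (dot (radproj x) A)%:E) \_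
    (@ball3 R `&` [set x | x <> origin3 R] `&` @radproj R @^-1` sph_triangle A B C)) X =
  (cone_integrand X)%:E.
Proof.
rewrite patchE /cone_integrand; have [->|/eqP X0] := eqVneq (X : vec3 R) (origin3 R).
  (* The origin is excluded from the domain on the left; on the right the integrand vanishes there
     because [dot (origin3 R) A = 0]. *)
  rewrite memNset; last by move=> [[_]].
  have -> : dot (origin3 R) A = 0 by rewrite /dot/=; ring.
  by rewrite mul0r if_same.
case: ifPn => [/set_mem[[Xb _] /(radproj_sph_triangle X0)[x0 y0 z0]]|].
  rewrite x0 y0 z0/= -vnorm_le1 Xb; congr _%:E.
  by rewrite /radproj /dot/=; ring.
move/negP => nS; case: ifPn => // /and4P[x0 y0 z0 Xb]; exfalso; apply: nS.
apply/mem_set; split; first by split => //; rewrite /ball3/= vnorm_le1.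
exact/radproj_sph_triangle.
Qed.

Lemma measurable_cone_integrand : measurable_fun setT cone_integrand.
Proof.
have mid : measurable_fun setT (id : V3 -> V3) by exact: measurable_id.
have mlin (n : vec3 R) (f : V3 -> R) : (forall X, f X = dot X n) ->
    measurable_fun setT (fun X => 0 <= f X / D).
  move=> fE; apply: measurable_fun_ler => //; apply: measurable_funM => //.
  rewrite (_ : f = fun X => dot X n); last exact/funext.
  by apply: (measurable_dot (f := fun p => p)) => //; exact: measurable_cst.
apply: measurable_fun_ifT => //.
- apply: measurable_and; last apply: measurable_and; last apply: measurable_and.
  (* The three normals are the cross products of [B] and [A], of [A] and [C], and of [C] and [B]. *)
  + apply: (mlin (B.1.2 * A.2 - B.2 * A.1.2, B.2 * A.1.1 - B.1.1 * A.2,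
      B.1.1 * A.1.2 - B.1.2 * A.1.1)) => X.
    by rewrite /det3 /dot/=; ring.
  + apply: (mlin (C.2 * A.1.2 - C.1.2 * A.2, C.1.1 * A.2 - C.2 * A.1.1,
      C.1.2 * A.1.1 - C.1.1 * A.1.2)) => X.
    by rewrite /det3 /dot/=; ring.
  + apply: (mlin (C.1.2 * B.2 - C.2 * B.1.2, C.2 * B.1.1 - C.1.1 * B.2,
      C.1.1 * B.1.2 - C.1.2 * B.1.1)) => X.
    by rewrite /det3 /dot/=; ring.
  + by apply: measurable_fun_ler => //; exact: measurable_dot_self.
- apply: measurable_funM.
    by apply: (measurable_dot (f := fun p => p)) => //; exact: measurable_cst.
  rewrite (_ : (fun X : V3 => (vnorm X)^-1) = (@powR R)^~ (-1) \o (@vnorm R)); last first.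
    by apply/funext => X /=; rewrite powR_inv1// sqrtr_ge0.
  apply: measurableT_comp; first exact: measurable_powR.
  apply: measurableT_comp; first exact: measurable_sqrt.
  exact: measurable_dot_self.
Qed.

(** Cauchy-Schwarz bounds the integrand by the indicator of the unit ball, whose volume is
    finite. *)
Lemma integrable_cone_integrand :
  (@leb2 R \x mu)%E.-integrable setT (fun X : V3 => (cone_integrand X)%:E).
Proof.
have mg := measurable_cone_integrand.
apply: (@le_integrable _ _ _ _ _ _ _ (fun X : V3 => (if dot X X <= 1 then 1 else 0)%:E)) => //.
- exact/measurable_EFinP.
- move=> X _; rewrite !abse_EFin lee_fin /cone_integrand.
  case: ifPn => [/and4P[_ _ _ ->]|_]; last by rewrite normr0.
  have n_ge0 : 0 <= vnorm X by exact: sqrtr_ge0.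
  rewrite normr1 normrM normfV (ger0_norm n_ge0).
  have [n0|n0] := eqVneq (vnorm X) 0; first by rewrite n0 invr0 mulr0.
  have npos : 0 < vnorm X by rewrite lt_neqAle eq_sym n0.
  rewrite ler_pdivrMr// mul1r -ler_sqr ?nnegrE ?sqrtr_ge0// real_normK ?num_real//.
  by rewrite sqr_vnorm -[leRHS]mulr1 -A1; exact: dot_sqr_le.
- apply/integrableP; split.
    apply/measurable_EFinP; apply: measurable_fun_ifT => //.
    by apply: measurable_fun_ler => //; exact: measurable_dot_self.
  rewrite (eq_integral (fun X : V3 => (if dot X X <= 1 then 1 else 0)%:E)); last first.
    by move=> X _; rewrite gee0_abs// lee_fin; case: ifP.
  by have := leb3_ball3E R; rewrite leb3_ball3 leb3E => <-; rewrite ltry.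
Qed.

Lemma integral_cone_column (x y : R) : 0 < x ->
  (\int[mu]_z (cone_integrand (lin3 C B A (x, y, z)%R))%:E =
   if (0 <= y)%R then (Num.max 0 (1 - vnorm (lin3 C B A (x, y, 0))))%:E else 0)%E.
Proof.
move=> x0; set p := lin3 C B A (x, y, 0).
have gE (z : R) : cone_integrand (lin3 C B A (x, y, z)) =
  if (0 <= y) && ((0 <= z) && (z ^+ 2 + 2 * dot p A * z + dot p p <= 1)) then
    (z + dot p A) / Num.sqrt (z ^+ 2 + 2 * dot p A * z + dot p p) else 0.
  rewrite /cone_integrand; have [-> -> ->] := det3_lin3 C B A x y z.
  rewrite -/D !mulfK// (ltW x0)/=.
  have pA : dot (lin3 C B A (x, y, z)) A = z * dot A A + dot p A.
    by rewrite /p /dot/=; ring.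
  have pp : dot (lin3 C B A (x, y, z)) (lin3 C B A (x, y, z)) =
      z ^+ 2 * dot A A + 2 * dot p A * z + dot p p by rewrite /p /dot/=; ring.
  by rewrite /vnorm pA pp A1 !mulr1.
have [y0|y0] := leP 0 y; last first.
  by apply: integral0_eq => z _; rewrite gE leNgt y0.
rewrite -(integral_derive_norm_ball (dot_sqr_lt y A1 D0 x0)).
by apply: eq_integral => z _; rewrite gE y0.
Qed.

Lemma integral_cone : dot B B = 1 -> dot C C = 1 ->
  (\int[@leb2 R \x mu]_X (cone_integrand X)%:E =
   (`|D| * (arclen B C / sin (arclen B C) / 6))%:E)%E.
Proof.
move=> B1 C1.
have [igT <-] := integral_scales_leb3 D0 (scales_lin3 D0) integrable_cone_integrand.
rewrite EFinM; congr *%E.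
rewrite -(integral12_prod_meas1 igT).
have iF := integrable_fubini_F igT.
rewrite -(integral12_prod_meas1 iF).
have mFx := measurable_int _ (integrable_fubini_F iF).
set Fx := fubini_F _ _ in mFx *.
(* Columns with [x < 0] miss the cone; the negligible plane [x = 0] is then dropped, and for [0 < x]
   every column avoids the origin. *)
transitivity (\int[mu]_x (if (0 <= x)%R then Fx x else 0))%E.
  apply: eq_integral => x _; case: ifPn => //; rewrite -ltNge => x0.
  rewrite /Fx /fubini_F; apply: integral0_eq => y _; apply: integral0_eq => z _.
  rewrite /= /cone_integrand; have [-> _ _] := det3_lin3 C B A x y z.
  by rewrite -/D mulfK// leNgt x0.
rewrite -integral_if_gt0//.
set c := dot B C.
pose h (r : RM) : R := Num.max 0 (1 - r).
have mh : measurable_fun setT h by apply: measurable_maxr => //; exact: measurable_funB.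
have h0 r : 0 <= h r by rewrite le_max lexx.
transitivity (\int[mu]_x \int[mu]_y
   (if (0 < x)%R && (0 <= y)%R then h (Num.sqrt (x ^+ 2 + 2 * c * x * y + y ^+ 2)) else 0)%:E)%E.
  apply: eq_integral => x _; case: ifPn => x0; last by rewrite integral0_eq.
  apply: eq_integral => y _; rewrite [LHS](integral_cone_column y x0).
  case: ifPn => // y0; congr (h _)%:E; rewrite /vnorm; congr Num.sqrt.
  transitivity (x ^+ 2 * dot C C + 2 * c * x * y + y ^+ 2 * dot B B).
    by rewrite /c /dot/=; ring.
  by rewrite B1 C1 !mulr1.
(* If [c ^+ 2 = 1], the Gram determinant [D ^+ 2] would be minus a square, against [D != 0]. *)
have c1 : -1 < c < 1.
  have := sqr_det3 C B A; rewrite -/D A1 B1 C1 (dotC C B) -/c => D2.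
  have Dpos : 0 < D ^+ 2 by rewrite exprn_even_gt0.
  have c2 : 0 < 1 - c ^+ 2.
    have cle := dot_sqr_le B C; rewrite B1 C1 -/c mulr1 in cle.
    rewrite subr_gt0 lt_neqAle cle andbT; apply: contraTneq Dpos => ce.
    rewrite -leNgt (_ : D ^+ 2 = (1 - c ^+ 2) * (1 - dot A C ^+ 2) - (dot B A - c * dot A C) ^+ 2).
      by rewrite ce subrr mul0r sub0r oppr_le0 sqr_ge0.
    by rewrite D2; ring.
  by apply/andP; split; nra.
have ca : cos (arclen B C) = c by rewrite /arclen -/c acosK// in_itv/=; lra.
rewrite integral_quadrant//.
have -> : (\int[mu]_(s in `[0%R, +oo[) ((1 + 2 * c * s + s ^+ 2)^-1)%:E =
    (arclen B C / sin (arclen B C))%:E)%E.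
  rewrite -ca; apply: integral_inv_quadratic.
  by rewrite /arclen -/c acos_gt0 ?acos_ltpi//; lra.
rewrite [in RHS]EFinM; congr *%E.
rewrite -integral_radial_cone -(@integral_if_itv _ (fun r => 0 <= r <= 1) _ 0 1)//.
apply: eq_integral => r _; congr _%:E.
have [r0|r0|<-] := ltgtP 0 r => //=; last by rewrite mul0r if_same.
rewrite /h; case: ifPn => r1.
  by rewrite (max_idPr _)// subr_ge0.
by rewrite (max_idPl _) ?mulr0// subr_le0 ltW// ltNge.
Qed.
End triangle.

(** * The right angle and the constants *)

Theorem theorem2p4 (R : realType) (A B C : vec3 R) :
  sphere2 A -> sphere2 B -> sphere2 C ->
  det3 A B C != 0 ->
  sph_angle C A B = pi / 2 ->
  ((4 * pi)%:E * MA A (sph_triangle A B C) =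
   (2^-1 * arclen B C * sin (arclen C A))%:E)%E.
Proof.
move=> A1 B1 C1 dABC angle.
have dE : det3 C B A = - det3 A B C by rewrite /det3; ring.
have D0 : det3 C B A != 0 by rewrite dE oppr_eq0.
have right := sph_angle_pihalf_dot C1 angle.
have sE (u v : vec3 R) : dot u u = 1 -> dot v v = 1 ->
    sin (arclen u v) = Num.sqrt (1 - dot u v ^+ 2).
  move=> u1 v1; apply: sin_acos; rewrite -ler_norml -ler_sqr ?nnegrE//.
  by rewrite real_normK ?num_real// expr1n -(mulr1 1) -{1}u1 -v1; exact: dot_sqr_le.
have detE : `|det3 C B A| = sin (arclen B C) * sin (arclen C A).
  rewrite !sE// -sqrtrM; last first.
    by have := dot_sqr_le B C; rewrite B1 C1 mulr1 subr_ge0.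
  rewrite -sqrtr_sqr; congr Num.sqrt.
  (* With [cos c = cos a cos b] the Gram determinant factors as [(1 - cos a ^2) (1 - cos b ^2)]. *)
  rewrite sqr_det3 A1 B1 C1 (dotC C B) (dotC B A) right (dotC C A); ring.
have sn0 : sin (arclen B C) != 0.
  apply: contraNneq D0 => s0; move: detE; rewrite s0 mul0r => /eqP.
  by rewrite normr_eq0.
rewrite /MA /sphere_integral leb3_ball3 integral_mkcond.
have -> : (\int[@leb3 R]_x ((fun x => (dot (radproj x) A)%:E) \_
    (@ball3 R `&` [set x | x <> origin3 R] `&` @radproj R @^-1` sph_triangle A B C)) x =
  \int[@leb3 R]_X (cone_integrand A B C X)%:E)%E.
  by apply: eq_integral => X _; exact: cone_integrandE.
rewrite leb3E (integral_cone A1 D0 B1 C1) detE.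
(* Multiplying by [4 pi] and dividing by the volume [4 pi / 3] leaves a factor 3, which turns
   [1 / 6] into [1 / 2]; [sin a] cancels against the determinant. *)
rewrite inver gt_eqF ?divr_gt0 ?mulr_gt0 ?pi_gt0//.
rewrite -!EFinM; congr _%:E.
have pn0 : (pi : R) != 0 by rewrite gt_eqF// pi_gt0.
move: (@pi R) pn0 => p pn0.
by field; rewrite sn0 pn0.
Qed.
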